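(* Fix an integer $n>3$. The set of monodromy groups of triangles modulo $n$ consists (up to isomorphism) precisely of the groups of the form $(C_n\times C_{n/\alpha})\rtimes C_3$ where $\alpha\mid n$ and $\alpha=3^i\prod_j p_j^{n_j}$ with the $p_j$ primes congruent to $1$ modulo $3$, $i\in\{0,1\}$, and $n_j\ge0$. If $n=3$, the only possible monodromy group of a triangle modulo $n$ is $C_3\rtimes C_3$.
   Context: A triangle modulo $n$ is a triple of positive integers $[a_0,a_1,a_2]$ with $a_0+a_1+a_2=n$, $a_i<2n$, $a_i\ne n$, and $\gcd(a_0,a_1,a_2,n)=1$ (the triangle with angles $a_i\pi/n$). Its monodromy group is the group of permutations of $\mathbb{Z}/n\mathbb{Z}\times\mathbb{Z}/3\mathbb{Z}$ generated by $\sigma_0(m,i)=(m,i+1)$ and $\sigma_1(m,i)=(m-a_{i-1},i-1)$ (indices mod 3); this is the monodromy group of the dessin d'enfant drawn on the rational billiards surface of the triangle. $C_m$ is the cyclic group of order $m$.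
   Formalization: The action of C_3, unspecified in the text, is required to permute cyclically three generators of C_n×C_{n/α} with product 1; for arbitrary actions the claim fails (e.g. C_4×C_4×C_3 for n=4). It is also stated that every admissible α occurs. *)

(* Defs.v *)
From HB Require Import structures.
From mathcomp Require Import all_boot all_order all_algebra all_fingroup.
From mathcomp Require Import all_solvable.

Set Implicit Arguments.
Unset Strict Implicit.
Unset Printing Implicit Defensive.

Import GroupScope GRing.Theory.

Definition triangle (n : nat) (a : 'Z_3 -> nat) : Prop :=
  [/\ forall i, 0 < a i,
      a 0%R + a 1%R + a 2%R = n,
      forall i, a i < 2 * n,
      forall i, a i <> n
    & gcdn (gcdn (gcdn (a 0%R) (a 1%R)) (a 2%R)) n = 1]%N.

Section Monodromy.

(* 'Z_n is Z/nZ only for 1 < n; a triangle modulo n forces 3 <= n. *)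
Variables (n : nat) (a : 'Z_3 -> nat).

Definition sigma0_fun (x : 'Z_n * 'Z_3) : 'Z_n * 'Z_3 :=
  (x.1, x.2 + 1)%R.

Definition sigma1_fun (x : 'Z_n * 'Z_3) : 'Z_n * 'Z_3 :=
  (x.1 - (a (x.2 - 1))%:R, x.2 - 1)%R.

Lemma sigma0_inj : injective sigma0_fun.
Proof.
move=> [m i] [m' i'] e; have /= -> := congr1 fst e.
by have /= /(@addIr 'Z_3) -> := congr1 snd e.
Qed.

Lemma sigma1_inj : injective sigma1_fun.
Proof.
move=> [m i] [m' i'] e; have /= /(@addIr 'Z_3) ii' := congr1 snd e.
by have /= := congr1 fst e; rewrite ii' => /(@addIr 'Z_n) ->.
Qed.

Definition sigma0 : {perm ('Z_n * 'Z_3)} := perm sigma0_inj.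
Definition sigma1 : {perm ('Z_n * 'Z_3)} := perm sigma1_inj.

Definition monodromy_group : {group {perm ('Z_n * 'Z_3)}} :=
  <<[set sigma0; sigma1]>>%G.

End Monodromy.

Definition admissible (n alpha : nat) : Prop :=
  alpha %| n /\
  exists (i : nat) (s : seq (nat * nat)),
    [/\ i <= 1,
        forall q, q \in s -> prime q.1 /\ q.1 = 1 %[mod 3]
      & alpha = 3 ^ i * \prod_(q <- s) q.1 ^ q.2]%N.

(* h permutes cyclically three generators of K whose product is 1.  In the    *)
(* monodromy group of a triangle these generators are the translations by the *)
(* cyclic shifts of (a_0, a_1, a_2), and h is sigma0.  This is the action     *)
(* meant in (C_n x C_(n/alpha)) ><| C_3: an arbitrary action of C_3 (for      *)
(* instance the trivial one) does not in general give a monodromy group.      *)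
Definition rotates (gT : finGroupType) (h : gT) (K : {set gT}) : Prop :=
  exists2 v : gT, v * v ^ h * v ^ (h ^+ 2) = 1
                & <<[set v; v ^ h; v ^ (h ^+ 2)]>> = K.

(* G is a semidirect product (C_n x C_(n/alpha)) ><| C_3 for an action of the *)
(* above kind.  Zp m is cyclic of order m for all m > 0, including m = 1.     *)
Definition sdprod_form (n alpha : nat) (gT : finGroupType) (G : {group gT})
    : Prop :=
  exists K H : {group gT},
    [/\ K \isog setX (Zp n) (Zp (n %/ alpha)),
        H \isog Zp 3,
        K ><| H = G
      & exists2 h : gT, H :=: <[h]> & rotates h K].

Definition sdprod_C3_C3 (gT : finGroupType) (G : {group gT}) : Prop :=
  exists K H : {group gT}, [/\ K \isog Zp 3, H \isog Zp 3 & K ><| H = G].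

(* Main.v *)
Require Import Defs.
From mathcomp Require Import all_boot all_order all_algebra all_fingroup.
From mathcomp Require Import all_solvable all_field.
From mathcomp Require Import zify ring.

(* Let h = sigma0 and let v be the translation by (a_0, a_1, a_2).  Then       *)
(* sigma1 = (v h)^-1, so the monodromy group is K ><| <h>, where K is          *)
(* generated by v and its cyclic shift w = v^h.  Since a_0 + a_1 + a_2 = 0     *)
(* modulo n, K is the row space modulo n of a 2 x 2 matrix with coprime        *)
(* entries and determinant -N, where N = a_0^2 + a_0 a_2 + a_2^2; hence it is  *)
(* C_n x C_(n/alpha) with alpha = gcd(n, N), and the prime factors of the norm *)
(* form N give the shape of alpha.                                             *)
(*   Conversely, a group (C_n x C_m) ><| C_3 with m = n/alpha and a rotating h *)
(* satisfies w^m = v^(m b) for some b with alpha | b^2 + b + 1, and it is      *)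
(* determined up to isomorphism by (n, m, b).  Lifting b to c with             *)
(* gcd(n, c^2 + c + 1) = alpha, the triangle [1, n - 1 - c, c] realizes it.    *)

Set Implicit Arguments.
Unset Strict Implicit.
Unset Printing Implicit Defensive.

Import GroupScope GRing.Theory.

(** * Arithmetic of the form x^2 + x y + y^2 *)

(** Write K additively. Then 1 + h + h^2 = 0 on K, so K is Z[omega]/I, with v as 1 and h acting as
    omega. If K is C_n x C_m with n = m alpha, then I = m J where Z[omega]/J is cyclic of order
    alpha. Such a J is generated by alpha and omega - b with b^2 + b + 1 = 0 modulo alpha, and this
    b exists exactly for the alpha of the stated shape. [translation_group_basis] computes K for a
    triangle and [admissible_dvd_norm] gives the shape of alpha. Conversely, [admissible_root] and
    [exists_lift] produce a triangle for each alpha and b, [sdprod_form_rel] extracts b from an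
    abstract group, and [rotation_rel_isog] shows that (n, m, b) determines the group. For n = 3 the
    only triangle is [1, 1, 1], and groups of order 9 are abelian. *)

Section Arithmetic.

Local Open Scope nat_scope.

Lemma chinese_primes (tau : nat -> nat) (s : seq nat) :
  uniq s -> all prime s ->
  exists t, forall p, p \in s -> t = tau p %[mod p].
Proof.
elim: s => [|p s IHs] /=; first by exists 0.
case/andP=> pNs uniq_s /andP[p_pr s_pr].
have [t Ht] := IHs uniq_s s_pr.
have co : coprime p (\prod_(q <- s) q).
  elim: s s_pr pNs {IHs uniq_s Ht} => [|q s IHs] /=; first by rewrite big_nil coprimen1.
  case/andP=> q_pr s_pr; rewrite inE negb_or => /andP[pq ps].
  by rewrite big_cons coprimeMr IHs // prime_coprime // dvdn_prime2 // pq.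
exists (chinese p (\prod_(q <- s) q) (tau p) t) => q.
rewrite inE => /predU1P[->|qs]; first exact: chinese_modl.
have dvq : q %| \prod_(r <- s) r by rewrite (big_rem q) //= dvdn_mulr.
by rewrite -Ht // -(modn_dvdm _ dvq) chinese_modr // modn_dvdm.
Qed.

(** Pick a good residue at each prime divisor of m and glue them with [chinese_primes]: no prime can
    then divide both m and g t. *)
Lemma chinese_coprime (g : nat -> nat) (m : nat) :
    0 < m ->
    (forall p t t', t = t' %[mod p] -> g t = g t' %[mod p]) ->
    (forall p, prime p -> p %| m -> exists2 t, t < 3 & ~~ (p %| g t)) ->
  exists t, coprime m (g t).
Proof.
move=> m_gt0 g_mod g_nz.
(* In [iota 0 3] index and value agree, so [tau p] is itself the first good residue; the default 3
   cannot occur for a prime divisor of m. *)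
pose tau p := find (fun t => ~~ (p %| g t)) (iota 0 3).
have [|t Ht] := @chinese_primes tau _ (primes_uniq m).
  by apply/allP=> p; rewrite mem_primes => /andP[].
exists t; have d_gt0 : 0 < gcdn m (g t) by rewrite gcdn_gt0 m_gt0.
rewrite /coprime eqn_leq d_gt0 andbT leqNgt.
apply/negP=> /pdivP[p p_pr]; rewrite dvdn_gcd => /andP[pm].
rewrite /dvdn (g_mod _ _ _ (Ht p _)) ?mem_primes ?p_pr ?m_gt0 //.
have [t0 t0_lt pt0] := g_nz p p_pr pm.
have hasP : has (fun t => ~~ (p %| g t)) (iota 0 3).
  by apply/hasP; exists t0; rewrite ?mem_iota.
have := nth_find 0 hasP; rewrite nth_iota; first by rewrite /dvdn => /negP.
by move: hasP; rewrite has_find size_iota.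
Qed.

Section CubeRoots.

Variables (p : nat) (p_pr : prime p).

Lemma Fp_natr_eq0 m : ((m%:R : 'F_p) == 0)%R = (p %| m).
Proof. by rewrite (dvdn_pcharf (pchar_Fp p_pr)). Qed.

(** The ratio u = y / x in F_p is a root of 1 + u + u^2, so u^3 = 1. If p is 2 modulo 3, then u^p =
    u reads u^2 = u, hence u = 1 and 3 = 0 in F_p. *)
Lemma norm_dvd_prime x y :
    p %| x ^ 2 + x * y + y ^ 2 -> ~~ (p %| x) -> p = 3 \/ p = 1 %[mod 3].
Proof.
rewrite -!Fp_natr_eq0 !natrD natrM !natrX => N0 xnz.
have [u yE] : exists u : 'F_p, (y%:R = u * x%:R)%R.
  by exists (y%:R / x%:R)%R; rewrite mulfVK.
have {N0} u2 : (u ^+ 2 = - 1 - u)%R.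
  have : ((1 + u + u ^+ 2) * x%:R ^+ 2 == 0)%R.
    by apply: etrans N0; rewrite yE; apply/eqP/eqP => <-; ring.
  rewrite mulf_eq0 expf_eq0 (negPf xnz) orbF => /eqP u0.
  by apply/eqP; rewrite -subr_eq0 -u0; apply/eqP; ring.
have u3 : (u ^+ 3 = 1)%R by rewrite exprSr u2; ring: u2.
have pE := divn_eq p 3.
have := expf_card u; rewrite card_Fp // -(expr_mod _ u3).
case: (p %% 3) (ltn_pmod p (isT : 0 < 3)) pE => [|[|[|//]]] _ pE.
- move=> _; left; apply/eqP; rewrite eq_sym -(dvdn_prime2 (isT : prime 3) p_pr).
  by rewrite pE addn0 dvdn_mull.
- by move=> _; right.
move=> uu; have u1 : (u = 1)%R by rewrite -u3 exprSr uu -expr2 uu.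
left; apply/eqP; rewrite -(dvdn_prime2 p_pr) // -Fp_natr_eq0.
by move/eqP: u2; rewrite u1 -subr_eq0 => /eqP <-; apply/eqP; ring.
Qed.

(** Cauchy's theorem gives an element of order 3 in the unit group of F_p, whose order is p - 1. *)
Lemma exists_cube_root : p = 1 %[mod 3] -> exists r, p %| r ^ 2 + r + 1.
Proof.
move=> p1; have dv3 : 3 %| #|[set: {unit 'F_p}]|.
  rewrite card_finField_unit card_Fp // -subn1.
  by rewrite -eqn_mod_dvd ?prime_gt0 //; apply/eqP.
have [u _ u3] := Cauchy (isT : prime 3) dv3.
have u_neq1 : val u != 1%R.
  by apply/eqP=> u1; move: u3; rewrite (_ : u = 1%g) ?order1 //; apply: val_inj.
have v3 : (val u ^+ 3 - 1 = 0)%R.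
  by rewrite -FinRing.val_unitX -u3 expg_order; apply: subrr.
have : (val u ^+ 2 + val u + 1 == 0)%R.
  move/eqP: v3; have -> : (val u ^+ 3 - 1 = (val u - 1) * (val u ^+ 2 + val u + 1))%R.
    by ring.
  by rewrite mulf_eq0 subr_eq0 (negPf u_neq1).
by exists (val (val u)); rewrite -Fp_natr_eq0 !natrD natrX natr_Zp.
Qed.

End CubeRoots.

(** Checked by computation on residues modulo 9. This is what limits the exponent of 3 in alpha to
    1. *)
Lemma norm_dvd9 x y : 9 %| x ^ 2 + x * y + y ^ 2 -> 3 %| x.
Proof.
have E : x ^ 2 + x * y + y ^ 2
  = (x %% 9) ^ 2 + (x %% 9) * (y %% 9) + (y %% 9) ^ 2 %[mod 9].
  by rewrite -[RHS]modnDm -(modnDm ((x %% 9) ^ 2)) modnMm !modnXm (modnDm (x ^ 2)) modnDm.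
have all9 : all (fun r => all (fun s => (9 %| r ^ 2 + r * s + s ^ 2) ==> (3 %| r))
                              (iota 0 9)) (iota 0 9) by [].
rewrite /dvdn {}E -(@modn_dvdm 9 x 3) //.
have := allP (allP all9 (x %% 9) _) (y %% 9); rewrite !mem_iota !ltn_mod /=.
by move=> /(_ isT isT)/implyP.
Qed.

(** A prime dividing both alpha and x would divide y^2, hence x, y and n, against coprimality. So
    [norm_dvd_prime] and [norm_dvd9] apply at every prime divisor of alpha. *)
Lemma admissible_dvd_norm (n x y alpha : nat) :
    0 < alpha -> alpha %| n -> alpha %| x ^ 2 + x * y + y ^ 2 ->
    gcdn (gcdn x y) n = 1 ->
  admissible n alpha.
Proof.
move=> a_gt0 an aN co; split=> //.
have pNx p : prime p -> p %| alpha -> ~~ (p %| x).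
  move=> p_pr pa; apply/negP=> px.
  have : p %| y ^ 2.
    have := dvdn_trans pa aN; rewrite dvdn_addr //.
    by rewrite dvdn_add ?dvdn_exp ?dvdn_mulr.
  rewrite Euclid_dvdX // => /andP[py _].
  have : p %| gcdn (gcdn x y) n by rewrite !dvdn_gcd px py (dvdn_trans pa).
  by rewrite co dvdn1; case: eqP p_pr => // ->.
exists (logn 3 alpha), [seq (p, logn p alpha) | p <- primes alpha & p != 3]; split.
- rewrite leqNgt -(@pfactor_dvdn 3 2) //; apply/negP => a9.
  have := norm_dvd9 (dvdn_trans a9 aN).
  by apply/negP/pNx => //; apply: dvdn_trans a9.
- move=> q /mapP[p]; rewrite mem_filter mem_primes => /and4P[p3 p_pr _ pa] -> /=.
  split=> //; have [p3' | //] := norm_dvd_prime p_pr (dvdn_trans pa aN) (pNx p p_pr pa).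
  by rewrite p3' in p3.
- rewrite big_map big_filter {1}(prod_prime_decomp a_gt0) prime_decompE big_map.
  rewrite (bigID (pred1 3)) /=; congr (_ * _).
  rewrite (eq_bigr (fun=> 3 ^ logn 3 alpha)) => [|p /eqP-> //].
  rewrite big_const_seq (count_uniq_mem 3 (primes_uniq alpha)) lognE mem_primes.
  by case: [&& _, _ & _] => //=; rewrite muln1.
Qed.

(* A Hensel step if p divides A, and a Chinese remainder step otherwise. *)
Lemma root_step A p b :
    0 < A -> prime p -> p = 1 %[mod 3] -> A %| b ^ 2 + b + 1 ->
  exists c, A * p %| c ^ 2 + c + 1.
Proof.
move=> A_gt0 p_pr p1 /dvdnP[k bE].
have fE t : (b + A * t) ^ 2 + (b + A * t) + 1
    = A * (k + t * (2 * b + 1) + A * t ^ 2).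
  by nia.
suff [t pt] : exists t, p %| k + t * (2 * b + 1) + A * t ^ 2.
  by exists (b + A * t); rewrite fE dvdn_pmul2l.
have [pA | pNA] := boolP (p %| A).
  (* The derivative 2b + 1 is invertible modulo p: (2b + 1)^2 + 3 = 4 (b^2 + b + 1) and p is not
     3. *)
  have b2nz : (2 * b%:R + 1 : 'F_p)%R != 0%R.
    rewrite -natrM natr1 Fp_natr_eq0 //; apply/negP => pb.
    have : p %| 4 * (b ^ 2 + b + 1).
      by rewrite bE mulnCA dvdn_mull // dvdn_mull.
    have -> : 4 * (b ^ 2 + b + 1) = (2 * b).+1 ^ 2 + 3 by nia.
    rewrite dvdn_addr ?dvdn_exp // dvdn_prime2 // => /eqP p3.
    by rewrite p3 in p1.
  exists (val (- k%:R / (2 * b%:R + 1) : 'F_p)%R).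
  rewrite -Fp_natr_eq0 // 2!natrD !natrM natrD natrM natr_Zp.
  by move: pA; rewrite -Fp_natr_eq0 // => /eqP->; rewrite divfK // mul0r addr0 subrr.
have [r pr] := exists_cube_root p_pr p1.
(* Here t is chosen so that b + A t is the root r modulo p; A is then cancelled. *)
have [t tE] : exists t, (t%:R = (r%:R - b%:R) / A%:R :> 'F_p)%R.
  by exists (val ((r%:R - b%:R) / A%:R : 'F_p)%R); rewrite natr_Zp.
exists t; have := Euclid_dvdM A (k + t * (2 * b + 1) + A * t ^ 2) p_pr.
rewrite (negPf pNA) /= => <-.
rewrite -fE -Fp_natr_eq0 // 2!natrD natrX.
have -> : ((b + A * t)%:R = r%:R :> 'F_p)%R.
  by rewrite natrD natrM tE mulrC divfK ?Fp_natr_eq0 // addrC subrK.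
by rewrite -natrX -!natrD Fp_natr_eq0.
Qed.

(** Start from the root 1 modulo 3^i and adjoin the primes one factor at a time with [root_step]. *)
Lemma admissible_root n alpha :
  admissible n alpha -> exists b, alpha %| b ^ 2 + b + 1.
Proof.
case=> _ [i [s [i1 s1 ->]]].
elim: s s1 => [|[p e] s IHs] s1.
  rewrite big_nil muln1; exists 1.
  by case: i i1 => [|[|]].
have [/= p_pr p1] := s1 _ (mem_head _ _).
have {}s1 q : q \in s -> prime q.1 /\ q.1 = 1 %[mod 3].
  by move=> qs; apply: s1; rewrite inE qs orbT.
have s_gt0 : 0 < \prod_(q <- s) q.1 ^ q.2.
  rewrite big_seq; elim/big_ind: _ => // [x y x0 y0|q /s1[q_pr _]].
    by rewrite muln_gt0 x0.
  by rewrite expn_gt0 prime_gt0.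
rewrite big_cons mulnCA mulnC /=.
elim: e => [|e [b IHb]]; first by rewrite expn0 muln1; apply: IHs.
rewrite expnSr mulnA; apply: root_step IHb => //.
by rewrite !muln_gt0 !expn_gt0 (prime_gt0 p_pr) s_gt0.
Qed.

Lemma modn_quad d c : (c %% d) ^ 2 + c %% d + 1 = c ^ 2 + c + 1 %[mod d].
Proof.
by rewrite -[LHS]modnDml -(modnDm ((c %% d) ^ 2)) modnXm modn_mod modnDm modnDml.
Qed.

(* For c = b + alpha * t one has c^2 + c + 1 = alpha * g(t) with g quadratic,  *)
(* and g is nonzero at 0, 1 or 2 modulo each prime divisor of n / alpha.  For  *)
(* alpha = 1 this could yield c = 0 or c = n - 1, so c is given explicitly;    *)
(* no such c exists for alpha = 1 and n = 3.                                   *)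
Lemma exists_lift (n alpha b : nat) :
    3 < n -> alpha %| n -> alpha %| b ^ 2 + b + 1 ->
  exists c, [/\ 0 < c, c < n.-1, c = b %[mod alpha]
              & gcdn n (c ^ 2 + c + 1) = alpha].
Proof.
move=> n_gt3 an ab; have n_gt0 : 0 < n by apply: leq_trans n_gt3.
have a_gt0 := dvdn_gt0 n_gt0 an.
have [a1 | a_neq1] := eqVneq alpha 1.
  rewrite a1; have [/dvdnP[k nE] | n3] := boolP (3 %| n); last first.
    exists 1; split=> //; rewrite ?modn1 //; first by lia.
    by apply/eqP; rewrite -/(coprime _ _) coprime_sym prime_coprime.
  have co3 c : c %% 3 != 1 -> coprime 3 (c ^ 2 + c + 1).
    rewrite prime_coprime // /dvdn -modn_quad.
    by move: (c %% 3) (ltn_mod c 3) => [|[|[|]]].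
  (* With n = 3k, a multiple c of k has c^2 + c + 1 = 1 modulo k, and c must avoid 1 modulo 3: c = k
     works unless k is 1 modulo 3, and then c = 2k does. *)
  have [k1 | k1] := eqVneq (k %% 3) 1.
    exists (2 * k); split; rewrite ?modn1 //; try lia.
    apply/eqP; rewrite -/(coprime _ _) nE coprimeMl co3 ?andbT; last by lia.
    by rewrite /coprime (_ : _ + 1 = (4 * k + 2) * k + 1) ?gcdnMDl ?gcdn1 //; ring.
  exists k; split; rewrite ?modn1 //; try lia.
  apply/eqP; rewrite -/(coprime _ _) nE coprimeMl co3 ?andbT //.
  by rewrite /coprime (_ : _ + 1 = k.+1 * k + 1) ?gcdnMDl ?gcdn1 //; ring.
have [m nE] := dvdnP an; have [k bE] := dvdnP ab.
pose g t := k + t * (2 * b + 1) + alpha * t ^ 2.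
have fE t : (b + alpha * t) ^ 2 + (b + alpha * t) + 1 = alpha * g t.
  by rewrite /g; nia.
have m_gt0 : 0 < m by case: m nE n_gt0 => // ->.
have [||t co] := @chinese_coprime g m m_gt0.
- have g_mod p t : g t = g (t %% p) %[mod p].
    rewrite /g -[RHS]modnDm -(modnDmr k (t %% p * _)) modnMml.
    by rewrite -(modnMmr alpha ((t %% p) ^ 2)) modnXm modnMmr (modnDmr k) modnDm.
  by move=> p t t' tt'; rewrite g_mod tt' -g_mod.
- move=> p p_pr pm.
  have [p0 | ?] := boolP (p %| g 0); last by exists 0.
  have [p1 | ?] := boolP (p %| g 1); last by exists 1.
  have [p2 | ?] := boolP (p %| g 2); last by exists 2.
  (* The second difference of g is 2 alpha, so p divides it. But p = 2 is excluded because b^2 + b +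
     1 is odd, and p dividing alpha leads to p = 3 and 9 dividing b^2 + b + 1. *)
  have gE : g 2 + g 0 = 2 * g 1 + 2 * alpha by rewrite /g; ring.
  have pk : p %| k by move: p0; rewrite /g mul0n muln0 !addn0.
  have : p %| 2 * alpha.
    by have := dvdn_add p2 p0; rewrite gE dvdn_addr // dvdn_mull.
  have pfb : p %| b ^ 2 + b + 1 by rewrite bE dvdn_mulr.
  rewrite Euclid_dvdM // dvdn_prime2 // => /orP[/eqP p2' | pa].
    by move: pfb; rewrite p2' dvdn2 !oddD oddX /= addbb.
  have p2b : p %| (2 * b).+1.
    move: p1; rewrite /g exp1n muln1 mul1n dvdn_addl // dvdn_addr //.
    by rewrite addn1.
  have : p %| 4 * (b ^ 2 + b + 1) by rewrite dvdn_mull.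
  have -> : 4 * (b ^ 2 + b + 1) = (2 * b).+1 ^ 2 + 3 by ring.
  rewrite dvdn_addr ?dvdn_exp // dvdn_prime2 // => /eqP p3.
  have : 9 %| 1 ^ 2 + 1 * b + b ^ 2.
    have -> : 1 ^ 2 + 1 * b + b ^ 2 = b ^ 2 + b + 1 by ring.
    by rewrite bE (_ : 9 = p * p) ?dvdn_mul // p3.
  by move/norm_dvd9.
pose c := (b + alpha * t) %% n.
have cb : c = b %[mod alpha] by rewrite /c modn_dvdm // addnC mulnC modnMDl.
have gcdE : gcdn n (c ^ 2 + c + 1) = alpha.
  rewrite -gcdn_modr modn_quad gcdn_modr.
  by rewrite fE nE mulnC -muln_gcdr (eqP co) muln1.
have ac : alpha %| c ^ 2 + c + 1 by rewrite -gcdE dvdn_gcdr.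
(* Either extreme value, c = 0 or c = n - 1, would make alpha divide 1. *)
exists c; split=> //.
  rewrite lt0n; apply/eqP=> c0; rewrite c0 dvdn1 in ac.
  by rewrite ac in a_neq1.
have : c < n by rewrite ltn_mod.
rewrite -{1}(prednK n_gt0) ltnS leq_eqVlt => /predU1P[cE|//].
have f_c : c ^ 2 + c + 1 = c * n + 1 by rewrite -(prednK n_gt0) -cE; ring.
by move: ac; rewrite f_c dvdn_addr ?dvdn_mull // dvdn1 (negPf a_neq1).
Qed.

End Arithmetic.

(** * Groups with three rotated generators *)

(** Read as a presentation, with m dividing n and n / m dividing b^2 + b + 1, these relations
    describe (C_n x C_m) ><| C_3; b records how the cyclic groups of v and v^h overlap. *)
Definition rotation_rel (gT : finGroupType) (n m b : nat) (v h : gT) : Prop :=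
  [/\ v ^+ n = 1, h ^+ 3 = 1, v * v ^ h * v ^ (h ^+ 2) = 1, commute v (v ^ h)
    & (v ^ h) ^+ m = v ^+ (m * b)].

(** With w = v^h, the group K = <v, w> has order at most n m, since w^m lies in <v>. It is
    normalized by h because w^h = (v w)^-1, and h contributes a factor of at most 3. *)
Lemma card_rotation_rel (gT : finGroupType) n m b (v h : gT) :
    (0 < n)%N -> (0 < m)%N -> rotation_rel n m b v h ->
  (#|<<[set v; h]>>| <= 3 * n * m)%N.
Proof.
move=> n_gt0 m_gt0 [vn h3 vvv cvw wm]; set w := v ^ h in vvv cvw wm.
have cVW : <[w]> \subset 'C(<[v]>) by rewrite cent_cycle cycle_subG; apply/cent1P.
have nVW : <[w]> \subset 'N(<[v]>) := subset_trans cVW (cent_sub _).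
pose K := (<[v]> <*> <[w]>)%G.
have cardK : (#|K| <= n * m)%N.
  have nK : <[v]> <| K by rewrite /= normalYl.
  rewrite -(Lagrange (normal_sub nK)) leq_mul //.
    by rewrite dvdn_leq // order_dvdn vn.
  rewrite -card_quotient ?normal_norm //= joingC quotientYidr // quotient_cycle.
    rewrite dvdn_leq // -[#|_|]/(#[_]) order_dvdn -morphX ?(subsetP nVW) ?cycle_id // wm.
    by rewrite -[_ == _]/(coset _ _ == 1) coset_id ?mem_cycle.
  by rewrite -cycle_subG.
have wK : w \in K by rewrite mem_gen // inE cycle_id orbT.
have vK : v \in K by rewrite mem_gen // inE cycle_id.
have wh : w ^ h \in K.
  have -> : w ^ h = (v * w)^-1.
    by apply/eqP; rewrite eq_sym eq_invg_mul /w -conjgM vvv.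
  by rewrite groupV groupM.
have nKh : <[h]> \subset 'N(K).
  rewrite cycle_subG; apply/normP/eqP; rewrite eqEcard cardJg leqnn andbT.
  by rewrite /= -genJ conjUg -!cycleJ gen_subG subUset !cycle_subG -/w wK wh.
have sub : <<[set v; h]>> \subset K * <[h]>.
  rewrite -norm_joinEr // gen_subG subUset !sub1set mem_gen ?inE ?vK //=.
  by rewrite mem_gen // inE cycle_id orbT.
rewrite (leq_trans (subset_leq_card sub)) //.
rewrite (leq_trans (leq_pmulr _ (cardG_gt0 (K :&: <[h]>)))) // -mul_cardG.
by rewrite -mulnA mulnC leq_mul // dvdn_leq // order_dvdn h3.
Qed.

Lemma isog_morphim_leq (aT rT : finGroupType) (f : {morphism [set: aT] >-> rT})
    (D : {group aT}) : (#|D| <= #|f @* D|)%N -> D \isog f @* D.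
Proof.
move=> leDfD; apply/isogP; exists (restrm_morphism (subsetT D) f).
  by rewrite -card_im_injm /= morphim_restrm setIid eqn_leq leDfD leq_morphim.
by rewrite /= morphim_restrm setIid.
Qed.

Lemma expg_pair (gT rT : finGroupType) (x : gT) (y : rT) k :
  (x, y) ^+ k = (x ^+ k, y ^+ k).
Proof. by elim: k => // k IHk; rewrite !expgS IHk. Qed.

(* A Goursat argument: by the cardinality bound the subgroup of gT * rT       *)
(* generated by the two pairs of generators projects isomorphically onto both *)
(* factors.                                                                   *)
Lemma rotation_rel_isog (gT rT : finGroupType) (G : {group gT}) (G' : {group rT})
    n m b (v h : gT) (v' h' : rT) :
    (0 < n)%N -> (0 < m)%N ->
    rotation_rel n m b v h -> rotation_rel n m b v' h' ->
    <<[set v; h]>> = G -> <<[set v'; h']>> = G' ->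
    (#|G| = 3 * n * m)%N -> (#|G'| = 3 * n * m)%N ->
  G \isog G'.
Proof.
move=> n_gt0 m_gt0 [vn h3 vvv cvw wm] [vn' h3' vvv' cvw' wm'] defG defG' cardG cardG'.
have rel : @rotation_rel (gT * rT)%type n m b (v, v') (h, h').
  have wE : (v, v') ^ (h, h') = (v ^ h, v' ^ h') by [].
  split; rewrite ?wE ?expg_pair ?vn ?vn' ?h3 ?h3' ?wm ?wm' //.
    by rewrite -[LHS]/(v * v ^ h * v ^ (h ^+ 2), v' * v' ^ h' * v' ^ (h' ^+ 2)) vvv vvv'.
  by rewrite /commute -[LHS]/(v * v ^ h, v' * v' ^ h') cvw cvw'.
pose D := <<[set (v, v'); (h, h')]>>%G.
have leD : (#|D| <= 3 * n * m)%N := card_rotation_rel n_gt0 m_gt0 rel.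
have im1 : fst_morphism gT rT @* D = G.
  rewrite morphim_gen ?subsetT // morphimU -defG; congr <<_ :|: _>>;
  by rewrite morphim_set1 ?inE.
have im2 : snd_morphism gT rT @* D = G'.
  rewrite morphim_gen ?subsetT // morphimU -defG'; congr <<_ :|: _>>;
  by rewrite morphim_set1 ?inE.
have DG : D \isog G by rewrite -im1 isog_morphim_leq // im1 cardG.
by rewrite -(isog_transl _ DG) -im2 isog_morphim_leq // im2 cardG'.
Qed.

Lemma sdprod_form_card n alpha (gT : finGroupType) (G : {group gT}) :
    (0 < n)%N -> (alpha %| n)%N -> sdprod_form n alpha G ->
  #|G| = (3 * n * (n %/ alpha))%N.
Proof.
move=> n_gt0 an [K [H [isoK isoH defG _]]].
rewrite -(sdprod_card defG) (card_isog isoK) (card_isog isoH) cardsX !card_Zp //.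
  by rewrite mulnC mulnA.
by rewrite divn_gt0 ?(dvdn_gt0 n_gt0) // dvdn_leq.
Qed.

Lemma cyclic_Zp m : cyclic (Zp m).
Proof.
rewrite /Zp; case: ifP => _; last exact: cyclic1.
by rewrite Zp_cycle cycle_cyclic.
Qed.

Lemma exponent_setX_Zp n m : (0 < n)%N -> (0 < m)%N -> (m %| n)%N ->
  exponent (setX (Zp n) (Zp m)) = n.
Proof.
move=> n_gt0 m_gt0 mn; rewrite -(dprod_exponent (setX_dprod _ _)).
rewrite -(exponent_isog (isog_setX1 _ _)) -(exponent_isog (isog_set1X _ _)).
by rewrite !exponent_cyclic ?cyclic_Zp // !card_Zp //; apply/lcmn_idPl.
Qed.

Lemma abelian_setX (gT rT : finGroupType) (A : {group gT}) (B : {group rT}) :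
  abelian A -> abelian B -> abelian (setX A B).
Proof.
move=> /centsP cA /centsP cB; apply/centsP=> -[x1 y1] + [x2 y2].
rewrite !inE /= => /andP[x1A y1B] /andP[x2A y2B].
by rewrite /commute -[LHS]/(x1 * x2, y1 * y2) cA // cB.
Qed.

(* Write K = <v, w> with w = v ^ h, and m = n / alpha.  Then v has order n and *)
(* K / <v> has order m, so that w ^ m = v ^ c with m | c by comparing orders;  *)
(* taking b = c / m, the relation v * w * w ^ h = 1 raised to the power m      *)
(* yields n | m * (b^2 + b + 1).                                               *)
Lemma sdprod_form_rel n alpha (gT : finGroupType) (G : {group gT}) :
    (0 < n)%N -> (alpha %| n)%N -> sdprod_form n alpha G ->
  exists b v h, [/\ alpha %| b ^ 2 + b + 1,
    rotation_rel n (n %/ alpha) b v h & <<[set v; h]>> = G].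
Proof.
move=> n_gt0 an sdG; have cardG := sdprod_form_card n_gt0 an sdG.
case: sdG => K [H [isoK isoH defG [h defH [v vvv genK]]]].
set m := (n %/ alpha)%N in isoK cardG *.
have a_gt0 := dvdn_gt0 n_gt0 an.
have m_gt0 : (0 < m)%N by rewrite divn_gt0 // dvdn_leq.
have nE : n = (m * alpha)%N by rewrite divnK.
have mn : (m %| n)%N by rewrite nE dvdn_mulr.
clearbody m.
set w := v ^ h in vvv genK.
have h2E : v ^ (h ^+ 2) = w ^ h by rewrite expgS expg1 conjgM.
rewrite h2E in vvv genK.
have vK : v \in K by rewrite -genK mem_gen // !inE eqxx.
have wK : w \in K by rewrite -genK mem_gen // !inE eqxx orbT.
have abK : abelian K.
  by rewrite (isog_abelian isoK) abelian_setX ?cyclic_abelian ?cyclic_Zp.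
have expK : exponent K = n by rewrite (exponent_isog isoK) exponent_setX_Zp.
have cardK : #|K| = (n * m)%N by rewrite (card_isog isoK) cardsX !card_Zp.
have cvw : commute v w by apply: (centsP abK).
have cVW : <[w]> \subset 'C(<[v]>) by rewrite cent_cycle cycle_subG; apply/cent1P.
have nVW : <[w]> \subset 'N(<[v]>) := subset_trans cVW (cent_sub _).
have whE : w ^ h = (v * w)^-1.
  by apply/eqP; rewrite eq_sym eq_invg_mul vvv.
have defK : <[v]> <*> <[w]> = K.
  apply/eqP; rewrite eqEsubset join_subG !cycle_subG vK wK -genK gen_subG.
  rewrite !subUset !sub1set whE.
  have vVW : v \in <[v]> <*> <[w]> by rewrite mem_gen // inE cycle_id.
  have wVW : w \in <[v]> <*> <[w]> by rewrite mem_gen // inE cycle_id orbT.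
  by rewrite vVW wVW groupV groupM.
(* The exponent n of K is the lcm of the orders of v and w, which are equal by conjugacy. *)
have ov : #[v] = n.
  rewrite -expK -(cprod_exponent (etrans (cprodEY cVW) defK)) !exponent_cycle.
  by rewrite /w orderJ; apply/esym/lcmn_idPl.
have wm : w ^+ m \in <[v]>.
  have nvw : w \in 'N(<[v]>) by rewrite -cycle_subG.
  have cardQ : #|K / <[v]>| = m.
    rewrite card_quotient -?divgS ?cycle_subG ?cents_norm ?(centsS _ abK) //.
    - by rewrite cardK -orderE ov mulKn.
    by rewrite cycle_subG.
  apply: coset_idr; first by rewrite groupX.
  by rewrite morphX // -cardQ expg_cardG ?mem_quotient.
have /cycleP[c cE] := wm.
have mc : (m %| c)%N.
  have : #[w ^+ m] = #[v ^+ c] by rewrite cE.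
  rewrite orderXgcd orderXgcd /w orderJ ov.
  rewrite (gcdn_idPr mn) => /esym gE.
  have /eqP : (n %/ m * gcdn n c = n %/ m * m)%N by rewrite -{1}gE !divnK ?dvdn_gcdl.
  have nm_gt0 : (0 < n %/ m)%N by rewrite divn_gt0 // dvdn_leq.
  by rewrite eqn_pmul2l // => /eqP gm; rewrite -gm dvdn_gcdr.
have [b bE] := dvdnP mc.
have wmE : w ^+ m = v ^+ (m * b) by rewrite cE bE mulnC.
exists b, v, h; split.
- rewrite -(dvdn_pmul2l m_gt0) -nE -ov order_dvdn.
  have := congr1 (fun x => x ^+ m) vvv.
  have cvww : commute (v * w) (w ^ h) by rewrite whE; apply/commuteV.
  rewrite expg1n (expgMn _ cvww) (expgMn _ cvw).
  rewrite -(conjXg w) wmE conjXg -/w (expgM w) wmE -expgM -!expgD.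
  by move=> <-; apply/eqP; congr (_ ^+ _); ring.
- split=> //.
  + by rewrite -ov expg_order.
  + have hH : h \in H by rewrite defH cycle_id.
    by rewrite -(expg_cardG hH) (card_isog isoH) card_Zp.
  + by rewrite h2E.
- apply/eqP; have [_ defG' _ _] := sdprodP defG.
  rewrite eqEsubset gen_subG subUset !sub1set -defG' defH.
  rewrite (subsetP (mulG_subl _ _)) // (subsetP (mulG_subr _ _)) ?cycle_id //=.
  have vM : v \in <<[set v; h]>> by rewrite mem_gen // !inE eqxx.
  have hM : h \in <<[set v; h]>> by rewrite mem_gen // !inE eqxx orbT.
  by rewrite mul_subG ?cycle_subG // -defK join_subG !cycle_subG vM groupJ.
Qed.

(** * Monodromy groups of triangles *)

Section Translations.

Variable n : nat.
Implicit Types p q : 'Z_n.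

(** Coordinates 0 and 2 parametrize zero-sum vectors so that the cyclic shift becomes (p, q) -> (q,
    - p - q). *)
Definition shift p q (i : 'Z_3) : 'Z_n :=
  (if i == 0 then p else if i == 2 then q else - p - q)%R.

Definition translation_fun p q (x : 'Z_n * 'Z_3) : 'Z_n * 'Z_3 :=
  (x.1 + shift p q x.2, x.2)%R.

Lemma translation_inj p q : injective (translation_fun p q).
Proof.
move=> [m i] [m' i'] e; have /= ii' := congr1 snd e.
by have := congr1 fst e; rewrite /= ii' => /(@addIr 'Z_n) ->.
Qed.

(* The translation by (p, - p - q, q). *)
Definition translation p q : {perm 'Z_n * 'Z_3} := perm (@translation_inj p q).

Lemma translationE p q m i : translation p q (m, i) = (m + shift p q i, i)%R.
Proof. by rewrite permE. Qed.

Lemma translationM p q p' q' :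
  translation p q * translation p' q' = translation (p + p')%R (q + q')%R.
Proof.
apply/permP=> -[m i]; rewrite permM !translationE; congr (_, _).
rewrite -addrA; congr (_ + _)%R; rewrite /shift.
by do 2!case: ifP => // _; ring.
Qed.

Lemma translation0 : translation 0%R 0%R = 1.
Proof.
by apply/permP=> -[m i]; rewrite translationE perm1 /shift !oppr0 !addr0 !if_same addr0.
Qed.

Lemma translationV p q : (translation p q)^-1 = translation (- p)%R (- q)%R.
Proof.
by apply/eqP; rewrite eq_invg_mul translationM !subrr translation0.
Qed.

Lemma translationX p q k :
  translation p q ^+ k = translation (p *+ k)%R (q *+ k)%R.
Proof.
elim: k => [|k IHk]; first by rewrite !mulr0n translation0.
by rewrite expgS IHk translationM !mulrS.
Qed.

Lemma translation_eq p q p' q' :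
  translation p q = translation p' q' -> p = p' /\ q = q'.
Proof.
move=> e; split.
  have := congr1 (fun s : {perm _} => (s (0, 0)%R).1) e.
  by rewrite !translationE /= !add0r.
have := congr1 (fun s : {perm _} => (s (0, 2)%R).1) e.
by rewrite !translationE /= !add0r.
Qed.

Lemma sigma0E (m : 'Z_n) (i : 'Z_3) : sigma0 n (m, i) = (m, i + 1)%R.
Proof. by rewrite permE. Qed.

Lemma translationJ p q : translation p q ^ sigma0 n = translation q (- p - q)%R.
Proof.
apply/permP=> -[m i]; rewrite conjgE.
have -> : (m, i) = sigma0 n (m, i - 1)%R by rewrite sigma0E subrK.
rewrite !permM permK translationE !sigma0E translationE subrK; congr (_ + _, _)%R.
rewrite /shift; case: i => [[|[|[|//]]] lti]; rewrite -!val_eqE /=; ring.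
Qed.

Lemma sigma0_order : #[sigma0 n] = 3.
Proof.
apply: nt_prime_order => //.
  apply/permP=> -[m i]; rewrite perm1 !expgS expg0 mulg1 !permM !sigma0E -!addrA.
  by congr (_, _); rewrite (_ : (1 + (1 + 1) = 0 :> 'Z_3)%R) ?addr0 //; apply: val_inj.
by apply/eqP=> /permP/(_ (0, 0)%R); rewrite perm1 sigma0E => -[].
Qed.

(** Allows exponents in ['Z_n], so that Bezout coefficients and negatives serve as exponents. *)
Lemma translation_scale p q (s : 'Z_n) :
  translation p q ^+ s = translation (s * p)%R (s * q)%R.
Proof. by rewrite translationX -(mulr_natl p) -(mulr_natl q) natr_Zp. Qed.

End Translations.

Lemma Zp_natr_eq0 n k : (1 < n)%N -> ((((k%:R)%R : 'Z_n) == 0%R) = (n %| k)).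
Proof. by move=> n_gt1; rewrite -val_eqE /= val_Zp_nat. Qed.

(** gcd(p, q) is an integral combination of p and q, and a unit modulo n. *)
Lemma Zp_Bezout n p q : (1 < n)%N -> (0 < p)%N -> gcdn (gcdn p q) n = 1%N ->
  exists s t : 'Z_n, (s * p%:R + t * q%:R = 1)%R.
Proof.
move=> n_gt1 p_gt0 co; have [a _ /dvdnP[u uE]] := Bezoutl q p_gt0.
have gU : ((gcdn p q)%:R : 'Z_n)%R \is a GRing.unit.
  by rewrite unitZpE // /coprime gcdnC co.
exists (u%:R / (gcdn p q)%:R)%R, (- a%:R / (gcdn p q)%:R)%R.
apply: (mulIr gU); rewrite mul1r mulrDl (mulrAC _ p%:R%R) (mulrAC _ q%:R%R) !divrK //.
rewrite -natrM -uE natrD natrM; ring.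
Qed.

Section TranslationGroup.

Variables (n p q : nat) (n_gt1 : (1 < n)%N) (p_gt0 : (0 < p)%N).
Hypothesis co : gcdn (gcdn p q) n = 1%N.

Local Notation P := (p%:R : 'Z_n)%R.
Local Notation Q := (q%:R : 'Z_n)%R.
Local Notation v := (translation P Q).
Local Notation w := (translation Q (- P - Q)%R).
Local Notation h := (sigma0 n).
Local Notation N := (p ^ 2 + p * q + q ^ 2)%N.

(* The Smith normal form of the matrix with rows v and w. *)
Lemma translation_group_basis : exists c d : 'Z_n,
  let x := translation 1%R c in let y := translation 0%R d in
  [/\ <[x]> \x <[y]> = <<[set v; w]>>, #[x] = n & #[y] = n %/ gcdn n N].
Proof.
have [s [t st1]] := Zp_Bezout n_gt1 p_gt0 co.
(* x is v^s w^t, with first coordinate s p + t q = 1, and y is v^q w^(-p), whose first coordinate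
   vanishes and whose second is N. *)
pose c := (s * Q + t * (- P - Q))%R.
pose x := @translation n 1%R c; pose y := @translation n 0%R N%:R%R.
exists c, N%:R%R; rewrite -/x -/y /=.
have yE : y = translation 0%R 1%R ^+ N by rewrite translationX mul0rn.
have trX1 (a b : 'Z_n) k : (translation a b ^+ k == 1) = (a *+ k == 0)%R && (b *+ k == 0)%R.
  rewrite translationX -translation0.
  by apply/eqP/andP=> [/translation_eq[-> ->] | [/eqP-> /eqP->]].
have o1 : #[translation 0%R (1%R : 'Z_n)] = n.
  apply/eqP; rewrite eqn_dvd order_dvdn trX1 mul0rn eqxx Zp_natr_eq0 // dvdnn /=.
  have := expg_order (translation 0%R (1%R : 'Z_n)) => /eqP.
  by rewrite trX1 Zp_natr_eq0 // => /andP[].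
have ox : #[x] = n.
  apply/eqP; rewrite eqn_dvd order_dvdn trX1 Zp_natr_eq0 // dvdnn.
  rewrite -mulr_natl pchar_Zp // mul0r eqxx /=.
  by have := expg_order x => /eqP; rewrite trX1 Zp_natr_eq0 // => /andP[].
have oy : #[y] = n %/ gcdn n N by rewrite yE orderXgcd o1.
split=> //.
have cxy : <[y]> \subset 'C(<[x]>).
  rewrite cent_cycle cycle_subG; apply/cent1P.
  by rewrite /commute !translationM addrC (addrC c).
rewrite dprodE //; last first.
  apply/trivgP/subsetP=> z /setIP[/cycleP[i ->] /cycleP[j]].
  rewrite !translationX mul0rn => /translation_eq[/eqP i0 _].
  by rewrite Zp_natr_eq0 // in i0; rewrite -translationX -/x inE -order_dvdn ox.
rewrite -cent_joinEr //.
apply/eqP; rewrite eqEsubset join_subG !cycle_subG gen_subG subUset !sub1set.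
have xJ : x \in <[x]> <*> <[y]> by rewrite mem_gen // inE cycle_id.
have yJ : y \in <[x]> <*> <[y]> by rewrite mem_gen // inE cycle_id orbT.
have vG : v \in <<[set v; w]>> by rewrite mem_gen // !inE eqxx.
have wG : w \in <<[set v; w]>> by rewrite mem_gen // !inE eqxx orbT.
have sP : (s * P = 1 - t * Q)%R by apply: (addIr (t * Q)%R); rewrite st1 subrK.
have xE : x = v ^+ s * w ^+ t.
  by rewrite !translation_scale translationM st1.
have yvw : y = v ^+ Q * w ^+ (- P)%R.
  rewrite !translation_scale translationM /y !natrD natrM !natrX.
  by congr translation; ring.
(* The base change with rows (s, t) and (q, -p) has determinant -1; its inverse has rows (p, t) and
   (q, -s). *)
have vE : v = x ^+ P * y ^+ t.
  rewrite !translation_scale translationM !natrD natrM !natrX.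
  by congr translation; [ring | rewrite /c; ring: sP].
have wE : w = x ^+ Q * y ^+ (- s)%R.
  rewrite !translation_scale translationM !natrD natrM !natrX.
  by congr translation; [ring | rewrite /c; ring: sP].
have xG : x \in <<[set v; w]>> by rewrite xE groupM ?groupX.
have yG : y \in <<[set v; w]>> by rewrite yvw groupM ?groupX.
rewrite xG yG /=; apply/andP; split; first by rewrite vE groupM ?groupX.
by rewrite wE groupM ?groupX.
Qed.

Lemma sdprod_form_translation (G : {group {perm 'Z_n * 'Z_3}}) :
  <<[set v; h]>> = G -> sdprod_form n (gcdn n N) G.
Proof.
move=> defG; have [c [d [defK ox oy]]] := translation_group_basis.
have n_gt0 := ltnW n_gt1.
have vh : v ^ h = w by rewrite translationJ.
have vh2 : v ^ (h ^+ 2) = (v * w)^-1.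
  rewrite expgS expg1 conjgM vh translationJ translationM translationV.
  by congr translation; ring.
have vK : v \in <<[set v; w]>> by rewrite mem_gen // !inE eqxx.
have wK : w \in <<[set v; w]>> by rewrite mem_gen // !inE eqxx orbT.
have whK : w ^ h \in <<[set v; w]>>.
  by rewrite -{1}vh -conjgM -[h * h]/(h ^+ 2) vh2 groupV groupM.
have vG : v \in G by rewrite -defG mem_gen // !inE eqxx.
have hG : h \in G by rewrite -defG mem_gen // !inE eqxx orbT.
have nKh : <[h]> \subset 'N(<<[set v; w]>>).
  rewrite cycle_subG; apply/normP/eqP; rewrite eqEcard cardJg leqnn andbT.
  by rewrite -genJ conjUg !conjg_set1 vh gen_subG subUset !sub1set wK.
(* Translations fix the index in ['Z_3], which h moves. *)
have hNK : h \notin <<[set v; w]>>.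
  have [_ <- _ _] := dprodP defK.
  apply/negP => /mulsgP[_ _ /cycleP[i ->] /cycleP[j ->]].
  rewrite !translationX translationM => /permP/(_ (0, 0)%R).
  by rewrite sigma0E translationE => -[].
exists <<[set v; w]>>%G, <[h]>%G; split.
- rewrite (isog_dprod defK (setX_dprod _ _)) //.
    rewrite -(isog_transr _ (isog_setX1 _ _)).
    by rewrite isog_cyclic_card ?cycle_cyclic // cyclic_Zp card_Zp // -orderE ox eqxx.
  rewrite -(isog_transr _ (isog_set1X _ _)).
  rewrite isog_cyclic_card ?cycle_cyclic // cyclic_Zp card_Zp -?orderE ?oy ?eqxx //.
  by rewrite divn_gt0 ?gcdn_gt0 ?n_gt0 // dvdn_leq // dvdn_gcdl.
- by rewrite isog_cyclic_card ?cycle_cyclic // cyclic_Zp card_Zp // -orderE sigma0_order.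
- rewrite sdprodE //; last first.
    by rewrite setIC prime_TIg -?orderE ?sigma0_order // cycle_subG.
  rewrite -norm_joinEr //= -defG; apply/eqP; rewrite eqEsubset join_subG cycle_subG.
  rewrite !gen_subG !subUset !sub1set /= -/v defG vG hG -vh groupJ //=.
  by rewrite !mem_gen // inE ?cycle_id ?orbT // vh vK.
- exists h => //; exists v; rewrite vh vh2.
    by rewrite mulgV.
  apply/eqP; rewrite eqEsubset !gen_subG !subUset !sub1set vK wK groupV groupM //=.
  by rewrite !mem_gen // !inE eqxx ?orbT.
Qed.

(** In w^m = v^(m b), the first coordinate is the assumed congruence; the second becomes m (b^2 + b
    + 1) p = 0 on replacing m q by m b p. *)
Lemma translation_rotation_rel m b :
    m * q = m * b * p %[mod n] -> n %| m * (b ^ 2 + b + 1) ->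
  rotation_rel n m b v h.
Proof.
move=> mqE mb; have n_gt0 := ltnW n_gt1.
have natE k l : k = l %[mod n] -> (k%:R = l%:R :> 'Z_n)%R.
  by move=> kl; apply: val_inj; rewrite /= !val_Zp_nat.
have vh : v ^ h = w by rewrite translationJ.
split.
- by rewrite translationX -(mulr_natl P) -(mulr_natl Q) pchar_Zp // !mul0r translation0.
- by have := expg_order h; rewrite sigma0_order.
- rewrite expgS expg1 conjgM vh translationJ !translationM -[RHS]translation0.
  by congr translation; ring.
- by rewrite vh /commute !translationM; congr translation; ring.
have {mqE} mqE := natE _ _ mqE; rewrite !natrM in mqE.
have mb0 : (m%:R * (b%:R ^+ 2 + b%:R + 1) = 0 :> 'Z_n)%R.
  by apply/eqP; rewrite -Zp_natr_eq0 // natrM !natrD natrX in mb.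
rewrite vh !translationX -(mulr_natl P) -!(mulr_natl Q) -(mulr_natl (- P - Q)%R) natrM.
congr translation; first exact: mqE.
have -> : (m%:R * b%:R * Q = b%:R * (m%:R * Q))%R by ring.
rewrite mulrBr mqE; apply/eqP; rewrite -subr_eq0.
have -> : (m%:R * - P - m%:R * b%:R * P - b%:R * (m%:R * b%:R * P)
          = - (m%:R * (b%:R ^+ 2 + b%:R + 1)) * P :> 'Z_n)%R by ring.
by rewrite mb0 oppr0 mul0r.
Qed.

End TranslationGroup.

(** * Monodromy groups as groups of rotated translations *)

Lemma triangle_gt1 n a : triangle n a -> (1 < n)%N.
Proof. by case=> a_gt0 sum_a _ _ _; have := (a_gt0 0%R, a_gt0 1%R); case=> *; lia. Qed.

(** [sigma1] undoes adding a_i and then stepping forward; the middle entry of the translation is a_1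
    because the a_i sum to 0 modulo n. *)
Lemma sigma1E n (a : 'Z_3 -> nat) : triangle n a ->
  sigma1 n a = (translation (a 0%R)%:R%R (a 2%R)%:R%R * sigma0 n)^-1.
Proof.
move=> tri; have n_gt1 := triangle_gt1 tri; have [_ sum_a _ _ _] := tri.
apply/eqP; rewrite eq_sym eq_invg_mul; apply/eqP.
have a1E : ((a 1%R)%:R = - (a 0%R)%:R - (a 2%R)%:R :> 'Z_n)%R.
  have : ((a 0%R + a 1%R + a 2%R)%:R = 0 :> 'Z_n)%R by rewrite sum_a pchar_Zp.
  rewrite !natrD => s0; apply/eqP; rewrite -subr_eq0 -s0; apply/eqP; ring.
apply/permP=> -[m i]; rewrite !permM translationE sigma0E perm1 permE /sigma1_fun /= addrK.
congr (_, _); rewrite -addrA -[RHS]addr0; congr (_ + _)%R.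
move: a1E; rewrite /shift; case: i => [[|[|[|//]]] lti] a1E /=.
- by rewrite (_ : Ordinal lti = 0%R) ?subrr //; apply: val_inj.
- by rewrite (_ : Ordinal lti = 1%R) ?a1E ?subrr //; apply: val_inj.
- by rewrite (_ : Ordinal lti = 2%R) ?subrr //; apply: val_inj.
Qed.

Lemma monodromy_group_gen n (a : 'Z_3 -> nat) : triangle n a ->
  <<[set translation (a 0%R)%:R%R (a 2%R)%:R%R; sigma0 n]>> = monodromy_group n a.
Proof.
move=> tri; rewrite /= (sigma1E tri); set v := translation _ _; set h := sigma0 n.
have vG : v \in <<[set v; h]>> by rewrite mem_gen // !inE eqxx.
have hG : h \in <<[set v; h]>> by rewrite mem_gen // !inE eqxx orbT.
have hM : h \in <<[set h; (v * h)^-1]>> by rewrite mem_gen // !inE eqxx.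
have vM : (v * h)^-1 \in <<[set h; (v * h)^-1]>> by rewrite mem_gen // !inE eqxx orbT.
apply/eqP; rewrite eqEsubset !gen_subG !subUset !sub1set hG hM groupV groupM //= !andbT.
by rewrite -(groupMr v hM) -groupV.
Qed.

Lemma triangle_gcd n (a : 'Z_3 -> nat) : triangle n a ->
  gcdn (gcdn (a 0%R) (a 2%R)) n = 1%N.
Proof.
case=> _ sum_a _ _ co; apply/eqP; rewrite -dvdn1.
set g := gcdn _ n; rewrite -[X in _ %| X]co.
have g0 : g %| a 0%R by rewrite (dvdn_trans (dvdn_gcdl _ _)) ?dvdn_gcdl.
have g2 : g %| a 2%R by rewrite (dvdn_trans (dvdn_gcdl _ _)) ?dvdn_gcdr.
have gn : g %| n := dvdn_gcdr _ _.
by rewrite !dvdn_gcd g0 g2 gn !andbT -(dvdn_addr _ g0) -(dvdn_addl _ g2) sum_a.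
Qed.

Lemma sdprod_form_monodromy n (a : 'Z_3 -> nat) : triangle n a ->
  sdprod_form n (gcdn n (a 0%R ^ 2 + a 0%R * a 2%R + a 2%R ^ 2)) (monodromy_group n a).
Proof.
move=> tri; have n_gt1 := triangle_gt1 tri; have [a_gt0 _ _ _ _] := tri.
by apply: sdprod_form_translation (triangle_gcd tri) _ (monodromy_group_gen tri).
Qed.

Lemma sdprod_form_isog n alpha (gT rT : finGroupType) (G : {group gT}) (M : {group rT}) :
  M \isog G -> sdprod_form n alpha M -> sdprod_form n alpha G.
Proof.
case/isogP=> f injf defG [K [H [isoK isoH defM [h defH [v vvv genK]]]]].
have [_ defM' _ _] := sdprodP defM.
have sKM : K \subset M by rewrite -defM' mulG_subl.
have sHM : H \subset M by rewrite -defM' mulG_subr.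
have hM : h \in M by rewrite (subsetP sHM) // defH cycle_id.
have vM : v \in M by rewrite (subsetP sKM) // -genK mem_gen // !inE eqxx.
have h2M : h ^+ 2 \in M by rewrite groupX.
have [vhM vh2M] : v ^ h \in M /\ v ^ (h ^+ 2) \in M by rewrite !groupJ.
exists (f @* K)%G, (f @* H)%G; split.
- by rewrite -(isog_transl _ (sub_isog sKM injf)).
- by rewrite -(isog_transl _ (sub_isog sHM injf)).
- by rewrite -defG; apply: injm_sdprod.
exists (f h); first by rewrite /= defH morphim_cycle.
exists (f v).
  have := congr1 f vvv.
  by rewrite morph1 (morphM f (groupM vM vhM)) // (morphM f vM) // !morphJ // morphX.
rewrite -morphX // -!morphJ // /= -genK morphim_gen.
  by rewrite !morphimU !morphim_set1.
by rewrite !subUset !sub1set vM vhM.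
Qed.

Lemma exists_triangle n alpha b :
    (3 < n)%N -> alpha %| n -> alpha %| b ^ 2 + b + 1 ->
  exists a : 'Z_3 -> nat, [/\ triangle n a,
    sdprod_form n alpha (monodromy_group n a), a 0%R = 1%N
    & a 2%R = b %[mod alpha]].
Proof.
move=> n_gt3 an ab; have [c [c_gt0 c_lt cb gcdE]] := exists_lift n_gt3 an ab.
(* The bound c < n - 1 keeps the truncated subtraction positive; the norm form of the entries 1 and
   c is c^2 + c + 1. *)
pose a (i : 'Z_3) := if i == 0%R then 1%N else if i == 2%R then c else (n.-1 - c)%N.
have tri : triangle n a.
  split; rewrite ?gcd1n //.
  - by move=> i; rewrite /a; do 2?case: ifP => // _; lia.
  - by rewrite /a /=; lia.
  - by move=> i; rewrite /a; do 2?case: ifP => // _; lia.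
  by move=> i; rewrite /a; do 2?case: ifP => // _; lia.
exists a; split=> //.
have := sdprod_form_monodromy tri.
by rewrite /a /= mul1n exp1n (_ : 1 + c + c ^ 2 = c ^ 2 + c + 1)%N ?gcdE //; ring.
Qed.

(** Both groups satisfy [rotation_rel] with the same b and have order 3 n m, so [rotation_rel_isog]
    applies. *)
Lemma sdprod_form_isog_monodromy n alpha (gT : finGroupType) (G : {group gT}) :
    (3 < n)%N -> alpha %| n -> sdprod_form n alpha G ->
  exists a : 'Z_3 -> nat, triangle n a /\ G \isog monodromy_group n a.
Proof.
move=> n_gt3 an sdG; have n_gt0 : (0 < n)%N by apply: leq_trans n_gt3.
have [b [v [h [ab rel_vh genG]]]] := sdprod_form_rel n_gt0 an sdG.
have [a [tri sdM a0 a2b]] := exists_triangle n_gt3 an ab.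
exists a; split=> //.
have a_gt0 := dvdn_gt0 n_gt0 an.
have m_gt0 : (0 < n %/ alpha)%N by rewrite divn_gt0 // dvdn_leq.
have nE : n = (n %/ alpha * alpha)%N by rewrite divnK.
have n_gt1 := triangle_gt1 tri.
have rel_M : rotation_rel n (n %/ alpha) b
    (translation (a 0%R)%:R%R (a 2%R)%:R%R) (sigma0 n).
  apply: translation_rotation_rel => //; last by rewrite {1}nE dvdn_pmul2l.
  (* Since n = m alpha, the congruence of a_2 and b modulo alpha scales by m to one modulo n. *)
  by rewrite a0 muln1 {2 4}nE -!muln_modr a2b.
apply: (rotation_rel_isog n_gt0 m_gt0 rel_vh rel_M genG (monodromy_group_gen tri)).
  exact: sdprod_form_card.
exact: sdprod_form_card.
Qed.

(** * The case n = 3 *)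

(** A group of order 9 is abelian, so the action is trivial and v^h = v, which gives the relations
    for m = b = 1. *)
Lemma sdprod_C3_C3_rel (gT : finGroupType) (G : {group gT}) :
  sdprod_C3_C3 G ->
  #|G| = 9 /\ exists v h, rotation_rel 3 1 1 v h /\ <<[set v; h]>> = G.
Proof.
case=> K [H [isoK isoH defG]].
have cardK : #|K| = 3 by rewrite (card_isog isoK) card_Zp.
have cardH : #|H| = 3 by rewrite (card_isog isoH) card_Zp.
have cardG : #|G| = 9 by rewrite -(sdprod_card defG) cardK cardH.
split=> //.
have abG : abelian G by apply: (@card_p2group_abelian _ 3); rewrite ?cardG.
have /cyclicP[v Kv] : cyclic K by rewrite prime_cyclic ?cardK.
have /cyclicP[h Hh] : cyclic H by rewrite prime_cyclic ?cardH.
have defKH := sdprodW defG.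
have vG : v \in G by rewrite -defKH (subsetP (mulG_subl _ _)) // Kv cycle_id.
have hG : h \in G by rewrite -defKH (subsetP (mulG_subr _ _)) // Hh cycle_id.
have v3 : v ^+ 3 = 1 by rewrite -cardK expg_cardG // Kv cycle_id.
have h3 : h ^+ 3 = 1 by rewrite -cardH expg_cardG // Hh cycle_id.
have vJ x : x \in G -> v ^ x = v by move=> xG; apply/conjg_fixP/commgP/(centsP abG).
exists v, h; split.
  by split; rewrite ?vJ ?groupX // -v3 !expgS expg0 mulg1 mulgA.
apply/eqP; rewrite eqEsubset gen_subG subUset !sub1set vG hG /= -defKH.
by rewrite mul_subG // ?Kv ?Hh cycle_subG mem_gen // !inE eqxx ?orbT.
Qed.

Lemma sdprod_form_C3_C3 (gT : finGroupType) (G : {group gT}) :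
  sdprod_form 3 3 G -> sdprod_C3_C3 G.
Proof.
case=> K [H [isoK isoH defG _]]; exists K, H; split=> //.
rewrite isog_sym isog_cyclic_card ?cyclic_Zp // (card_isog isoK) cardsX !card_Zp //=.
by rewrite andbT prime_cyclic // (card_isog isoK) cardsX !card_Zp.
Qed.

Lemma triangle3 (a : 'Z_3 -> nat) : triangle 3 a <-> a =1 (fun=> 1%N).
Proof.
split=> [[a_gt0 sum_a _ _ _] i | a1]; last by split=> [i||i|i|]; rewrite ?a1.
have := (a_gt0 0%R, a_gt0 1%R, a_gt0 2%R); case=> -[a0 a1 a2].
have [-> | [-> | ->]] : i = 0%R \/ i = 1%R \/ i = 2%R; try lia.
by case: i => [[|[|[|//]]] lti]; [left | right; left | right; right]; apply: val_inj.
Qed.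

Lemma sdprod_form_monodromy3 (a : 'Z_3 -> nat) :
  triangle 3 a -> sdprod_form 3 3 (monodromy_group 3 a).
Proof.
move=> tri; have := sdprod_form_monodromy tri.
by rewrite !((triangle3 a).1 tri).
Qed.

Theorem theorem6 :
  (forall n : nat, (3 < n)%N ->
     (forall (gT : finGroupType) (G : {group gT}),
        (exists a : 'Z_3 -> nat,
           triangle n a /\ G \isog monodromy_group n a) <->
        (exists alpha : nat, admissible n alpha /\ sdprod_form n alpha G)) /\
     (forall alpha : nat, admissible n alpha ->
        exists a : 'Z_3 -> nat,
          triangle n a /\ sdprod_form n alpha (monodromy_group n a))) /\
  (forall (gT : finGroupType) (G : {group gT}),
     (exists a : 'Z_3 -> nat,
        triangle 3 a /\ G \isog monodromy_group 3 a) <->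
     sdprod_C3_C3 G).
Proof.
split=> [n n_gt3|gT G].
  split=> [gT G|alpha adm]; last first.
    have [b ab] := admissible_root adm; have [an _] := adm.
    by have [a [tri sdM _ _]] := exists_triangle n_gt3 an ab; exists a.
  split=> [[a [tri isoG]] | [alpha [[an _] sdG]]].
    set alpha := gcdn n (a 0%R ^ 2 + a 0%R * a 2%R + a 2%R ^ 2).
    exists alpha; split.
      apply: (@admissible_dvd_norm _ (a 0%R) (a 2%R)); rewrite ?dvdn_gcdl ?dvdn_gcdr //.
        by rewrite gcdn_gt0 (ltnW (triangle_gt1 tri)).
      exact: triangle_gcd.
    by apply: sdprod_form_isog (sdprod_form_monodromy tri); rewrite isog_sym.
  exact: sdprod_form_isog_monodromy an sdG.
split=> [[a [tri isoG]] | sdG].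
  apply/sdprod_form_C3_C3/(sdprod_form_isog _ (sdprod_form_monodromy3 tri)).
  by rewrite isog_sym.
pose a (i : 'Z_3) := 1%N; have tri : triangle 3 a by apply/triangle3.
exists a; split=> //.
have [cardG [v [h [rel defG]]]] := sdprod_C3_C3_rel sdG.
have [cardM [v' [h' [rel' defM]]]] :=
  sdprod_C3_C3_rel (sdprod_form_C3_C3 (sdprod_form_monodromy3 tri)).
exact: rotation_rel_isog rel rel' defG defM _ _.
Qed.
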